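(* Let $X$ be a Banach space, $\alpha\in\omega_1\setminus\omega$, and let $\Sigma(a_i)_{i\in\alpha}$ be an absolutely convergent well-ordered series in $X$. Then for every bijection $f\colon\omega\to\alpha$, the series $\sum_{i=0}^\infty a_{f(i)}$ absolutely converges and \[\sum_{i=0}^\infty a_{f(i)}=\sum_{i\in\alpha}a_i.\]
   Context: Ordinals are von Neumann ordinals; $\omega$ is the set of finite ordinals, $\omega_1$ the set of countable ordinals. For a normed space $Y$ and $\beta\in\omega_1\setminus\omega$, a hypersequence is a function $a\colon\beta\to Y$. A function $s\colon\gamma\to Y$ is a partial sum hypersequence of $a$ if (1) $1\le\gamma\le\beta+1$; (2) $s_0=0$; (3) $s_{\alpha+1}=s_\alpha+a_\alpha$ whenever $\alpha+1\in\gamma$; (4) for each limit ordinal $\lambda\in\gamma$, $s_\lambda=\lim_{\alpha\to\lambda}s_\alpha$ (for every $\varepsilon>0$ there is $\alpha_0\in\lambda$ with $\|s_\lambda-s_\alpha\|<\varepsilon$ for all $\alpha_0\le\alpha<\lambda$). There is a largest partial sum hypersequence $\sigma a$ (every other one is a restriction of it). The well-ordered series $\Sigma a$ converges if the domain of $\sigma a$ is $\beta+1$, and then its sum is $\sum_{\alpha\in\beta}a_\alpha:=(\sigma a)_\beta$. The well-ordered series $\Sigma(a_\alpha)_{\alpha\in\beta}$ absolutely converges if $\Sigma(\|a_\alpha\|)_{\alpha\in\beta}$ converges. For $\beta=\omega$ these notions coincide with ordinary series convergence, sum, and absolute convergence. *)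

(* Defs.v *)
From HB Require Import structures.
From mathcomp Require Import all_boot all_order all_algebra.
From mathcomp Require Import all_classical all_reals all_analysis.
From mathcomp Require Export wochoice.

Set Implicit Arguments.
Unset Strict Implicit.
Unset Printing Implicit Defensive.

Import Order.TTheory GRing.Theory Num.Theory.
Import numFieldNormedType.Exports.

Local Open Scope classical_set_scope.
Local Open Scope ring_scope.

(* An ordinal beta is represented by a well-ordered type B (the order type of
   the elements of beta).  The ordinal beta + 1 is then [osucc B], in which
   [Some i] stands for the element i of beta and [None] for beta itself.
   An ordinal gamma <= beta + 1 is an initial segment of [osucc B]. *)

Definition osucc (B : Type) : Type := option B.

Section OrdinalSuccessor.
Context (d : Order.disp_t) (B : orderType d).
Implicit Types x y z : osucc B.

Definition osucc_le x y : bool :=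
  match x, y with
  | _, None => true
  | None, Some _ => false
  | Some i, Some j => (i <= j)%O
  end.

Definition osucc_lt x y : bool := (y != x :> option B) && osucc_le x y.
Definition osucc_meet x y : osucc B := if osucc_lt x y then x else y.
Definition osucc_join x y : osucc B := if osucc_lt x y then y else x.

Fact osucc_le_anti : antisymmetric osucc_le.
Proof. by case=> [i|] [j|] //= /le_anti ->. Qed.

Fact osucc_le_trans : transitive osucc_le.
Proof. by case=> [j|] [i|] [k|] //=; apply: le_trans. Qed.

Fact osucc_le_total : total osucc_le.
Proof. by case=> [i|] [j|] //=; apply: le_total. Qed.

HB.instance Definition _ := Choice.copy (osucc B) (option B).
HB.instance Definition _ := @Order.isOrder.Build d (osucc B)
  osucc_le osucc_lt osucc_meet osucc_join
  (fun _ _ => erefl) (fun _ _ => erefl) (fun _ _ => erefl)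
  osucc_le_anti osucc_le_trans osucc_le_total.

End OrdinalSuccessor.

Section OrdinalKinds.
Context (d : Order.disp_t) (T : orderType d).
Implicit Types x y z : T.

Definition is_zero x := forall y, (x <= y)%O.

(* y = x + 1 *)
Definition is_succ x y := (x < y)%O /\ forall z, (x < z)%O -> (y <= z)%O.

Definition is_limit x := ~ is_zero x /\ ~ exists y, is_succ y x.

(* Nonzero ordinals gamma not exceeding the order type of T. *)
Definition nonempty_segment (D : set T) :=
  D !=set0 /\ forall x y, (y <= x)%O -> D x -> D y.

End OrdinalKinds.

Section WellOrderedSeries.
Context (d : Order.disp_t) (B : orderType d).
Context (K : numFieldType) (Y : normedModType K).
Implicit Types (a : B -> Y) (D : set (osucc B)) (s : osucc B -> Y).

(* [s], restricted to [D], is a partial sum hypersequence of [a]; the values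
   of [s] outside [D] are irrelevant. *)
Definition partial_sum_hyperseq a D s :=
  [/\ nonempty_segment D,
      forall x, D x -> is_zero x -> s x = 0,
      forall (i : B) x, D x -> is_succ (Some i : osucc B) x ->
        s x = s (Some i) + a i
    & forall l, D l -> is_limit l -> forall e : K, 0 < e ->
        exists2 x0 : osucc B, (x0 < l)%O &
          forall x : osucc B, (x0 <= x)%O -> (x < l)%O -> `|s l - s x| < e].

(* The largest partial sum hypersequence, as the union of all of them; see
   [sigmaP] and [sigma_max].  [sigma a] takes the value 0 outside its domain. *)
Definition sigma_dom a : set (osucc B) :=
  [set x | exists D s, partial_sum_hyperseq a D s /\ D x].

Definition sigma a : osucc B -> Y := fun x =>
  xget 0 [set y | exists D s, [/\ partial_sum_hyperseq a D s, D x & y = s x]].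

Definition wo_converges a := sigma_dom a = setT.

(* Meaningful only if [wo_converges a]. *)
Definition wo_sum a : Y := sigma a None.

End WellOrderedSeries.

Definition wo_abs_converges (d : Order.disp_t) (B : orderType d)
    (K : numFieldType) (Y : normedModType K) (a : B -> Y) :=
  wo_converges (fun i => `|a i| : K^o).

Section SigmaTheory.
Context (d : Order.disp_t) (B : orderType d).
Context (K : numFieldType) (Y : normedModType K).
Hypothesis Bwo : well_order (<=%O : rel B).
Implicit Types (a : B -> Y) (D : set (osucc B)) (s : osucc B -> Y).

Lemma osucc_ind (P : osucc B -> Prop) :
  (forall x, (forall y, (y < x)%O -> P y) -> P x) -> forall x, P x.
Proof.
move=> IH.
have PS i : P (Some i).
  apply: contrapT => nPi.
  have [|m [[]]] := Bwo (A := [pred j | `[< ~ P (Some j) >]]).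
    by exists i; apply/asboolP.
  move=> /asboolP nPm minm _; apply: nPm; apply: IH => -[j|//] ltjm.
  apply: contrapT => nPj.
  have : (m <= j)%O by apply: minm; apply/asboolP.
  by move=> lemj; move: ltjm; rewrite ltNge => /negP; apply.
by case=> [i|]; [exact: PS | apply: IH => -[j _|//]; exact: PS].
Qed.

Lemma osucc_zero : exists x : osucc B, is_zero x.
Proof.
apply: contrapT => nz.
suff none (x : osucc B) : False by exact: none None.
elim/osucc_ind: x => x IH; apply: nz; exists x => y.
by rewrite leNgt; apply/negP => /IH.
Qed.

Lemma partial_sum_hyperseq_uniq a D s D' s' :
  partial_sum_hyperseq a D s -> partial_sum_hyperseq a D' s' ->
  forall x, D x -> D' x -> s x = s' x.
Proof.
move=> [[_ Dd] s0 sS sL] [[_ Dd'] s0' sS' sL'].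
elim/osucc_ind => x IH Dx Dx'.
have {}IH y : (y < x)%O -> s y = s' y.
  move=> yx; have ley := ltW yx.
  by apply: IH => //; [exact: Dd Dx | exact: Dd' Dx'].
have [zx|nzx] := pselect (is_zero x); first by rewrite s0 // s0'.
have [[[i|] ix]|nsx] := pselect (exists y, is_succ y x).
- by rewrite (sS i) // (sS' i) // IH //; case: ix.
- by case: ix => + _; case: x {IH nzx Dx Dx'}.
apply/eqP; rewrite -subr_eq0; apply: contrapT => /negP ne0.
have e0 : 0 < `|s x - s' x| / 2 by rewrite divr_gt0 // normr_gt0.
have [u ux Hu] := sL x Dx (conj nzx nsx) _ e0.
have [v vx Hv] := sL' x Dx' (conj nzx nsx) _ e0.
pose w := Order.max u v.
have wx : (w < x)%O by rewrite gt_max ux vx.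
have uw : (u <= w)%O by rewrite le_max lexx.
have vw : (v <= w)%O by rewrite le_max lexx orbT.
have := ltrD (Hu w uw wx) (Hv w vw wx).
rewrite -splitr (IH w wx) [X in _ + X]distrC => /(le_lt_trans (ler_normD _ _)).
by rewrite addrA subrK ltxx.
Qed.

Lemma sigmaE a D s : partial_sum_hyperseq a D s ->
  forall x, D x -> sigma a x = s x.
Proof.
move=> Ds x Dx.
have [D' [s' [Ds' Dx' ->]]] : [set y | exists D s,
    [/\ partial_sum_hyperseq a D s, D x & y = s x]] (sigma a x).
  by apply: (xgetPex 0); exists (s x), D, s.
exact: partial_sum_hyperseq_uniq Ds' Ds _ Dx' Dx.
Qed.

Lemma sigmaP a : partial_sum_hyperseq a (sigma_dom a) (sigma a).
Proof.
split; first split.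
- have [z zz] := osucc_zero; exists z, [set z], (fun=> 0).
  split=> //; split; first split.
  + by exists z.
  + by move=> x y + /= xz; rewrite xz => yz; apply/le_anti; rewrite yz zz.
  + by [].
  + by move=> i x /= -> [+ _]; rewrite ltNge zz.
  + by move=> x /= -> [].
- move=> x y yx [D [s [Ds Dx]]]; exists D, s; split=> //.
  by case: Ds => -[_ Dd] _ _ _; exact: Dd Dx.
- move=> x [D [s [Ds Dx]]] zx; rewrite (sigmaE Ds) //.
  by case: Ds => _ s0 _ _; exact: s0.
- move=> i x [D [s [Ds Dx]]] ix; rewrite (sigmaE Ds Dx).
  have [[_ Dd] _ sS _] := Ds.
  rewrite (sigmaE Ds (x := Some i)); first exact: sS.
  by apply: Dd Dx; case: ix => /ltW.
- move=> l [D [s [Ds Dl]]] ll e e0.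
  have [[_ Dd] _ _ sL] := Ds.
  have [x0 x0l H] := sL l Dl ll e e0; exists x0 => // x x0x xl.
  by rewrite !(sigmaE Ds) ?H //; apply: Dd Dl; exact: ltW.
Qed.

Lemma sigma_max a D s : partial_sum_hyperseq a D s ->
  D `<=` sigma_dom a /\ forall x, D x -> s x = sigma a x.
Proof.
move=> Ds; split=> [x Dx|x Dx]; first by exists D, s.
by rewrite (sigmaE Ds).
Qed.

End SigmaTheory.

(* Main.v *)
(** The terms |a i| are nonnegative, so by transfinite induction the partial sum
    of their series at [x] is the supremum of its finite sums over indices below
    [x].  Hence, for each e > 0, the norms outside some finite set of indices
    sum to less than e; this yields convergence of
    the series of those [a (f k)] with [f k < x], uniformly in [x].  Their sums
    satisfy the defining clauses of the partial sum hypersequence of [a], and at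
    the top element they give the sum of the rearranged series. *)
Require Import Defs.
From mathcomp Require Import all_boot all_order all_algebra.
From mathcomp Require Import all_classical all_reals all_analysis.

Set Implicit Arguments.
Unset Strict Implicit.
Unset Printing Implicit Defensive.

Import Order.TTheory GRing.Theory Num.Theory.
Import numFieldNormedType.Exports.

Local Open Scope classical_set_scope.
Local Open Scope ring_scope.

(* The order of a [numFieldType] may be partial, so [0 <= u] cannot be proved
   by excluding [u < 0]. *)
Lemma ge0_of_approx (K : numFieldType) (u : K) :
  (forall e, 0 < e -> exists2 t, 0 <= t & `|u - t| < e) -> 0 <= u.
Proof.
move=> H; suff /eqP <- : `|u| == u by [].
rewrite -subr_eq0; apply: contrapT => /negP ne0.
have e0 : 0 < `| `|u| - u| / 2 by rewrite divr_gt0 // normr_gt0.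
have [t t0 ut] := H _ e0.
suff : `| `|u| - u| < `| `|u| - u| by rewrite ltxx.
rewrite -{1}[`|u|](subrK t) -addrA.
apply: le_lt_trans (ler_normD _ _) _; rewrite [ltRHS]splitr ltrD //.
  by apply: le_lt_trans ut; rewrite -{1}(ger0_norm t0) ler_dist_dist.
by rewrite distrC.
Qed.

(** The increments of [b] serve as a Cauchy modulus for [u]. The resulting error [L - b n] does not
    depend on [u], so all sequences dominated by one [b] converge uniformly. *)
Lemma cvg_dominated (K : numFieldType) (X : completeNormedModType K)
    (u : nat -> X) (b : nat -> K) (L : K) :
  (forall m n, (m <= n)%N -> `|u n - u m| <= b n - b m) ->
  (forall n, b n <= L) ->
  (forall e, 0 < e -> exists N, L - b N < e) ->
  cvgn u /\ forall n, `|limn u - u n| <= L - b n.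
Proof.
move=> ub bL Lb.
have cu : cvgn u.
  apply/cauchy_cvgP/cauchy_exP => e e0.
  have [N HN] := Lb e e0; exists (u N).
  exists N => // n /= Nn; rewrite -ball_normE /ball_ /= distrC.
  by apply: le_lt_trans HN; apply: le_trans (ub _ _ Nn) _; rewrite lerD2r.
split=> // n; apply/ler_addgt0Pr => e e0.
have [N _ HN] := (cvgrPdist_lt u (limn u)).1 cu e e0.
have /ltW := HN (maxn N n) (leq_maxl _ _).
have := ub _ _ (leq_maxr N n) => le1 le2.
rewrite -(subrK (u (maxn N n)) (limn u)) -addrA addrC.
apply: le_trans (ler_normD _ _) _; apply: lerD; last by [].
by apply: le_trans le1 _; rewrite lerD2r.
Qed.

Section Rearrangement.
Context (d : Order.disp_t) (A : orderType d) (f : nat -> A).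
Implicit Types (x y l : osucc A) (n : nat).

Let below x k := ((Some (f k) : osucc A) < x)%O.

(** A limit has no largest element below it: the maximum of the previous bound and [f n] is not the
    predecessor of [l], which leaves room for a strictly larger bound still below [l]. *)
Lemma limit_bound l n : is_limit l -> exists2 y, (y < l)%O &
  forall k, (k < n)%N -> below l k -> below y k.
Proof.
move=> [l_nz l_nsucc]; elim: n => [|n [y yl IH]].
  have [[y yl]|H] := pselect (exists y, (y < l)%O); first by exists y.
  case: l_nz => z; rewrite leNgt; apply/negP => zl.
  by apply: H; exists z.
have [fl|nfl] := boolP (below l n); last first.
  exists y => // k; rewrite ltnS leq_eqVlt => /predU1P[->|]; last exact: IH.
  by rewrite (negbTE nfl).
pose m := Order.max y (Some (f n)).
have ml : (m < l)%O by rewrite gt_max yl.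
have [z mz zl] : exists2 z, (m < z)%O & (z < l)%O.
  apply: contrapT => H; apply: l_nsucc; exists m; split=> // z mz.
  by rewrite leNgt; apply/negP => zl; apply: H; exists z.
move: mz; rewrite gt_max => /andP[yz fz].
exists z => // k; rewrite ltnS leq_eqVlt => /predU1P[->//|kn] /(IH _ kn).
by move/lt_trans; apply.
Qed.

Section Partial.
Context (V : zmodType) (a : A -> V).

(** Terms not below [x] become 0 instead of being dropped, so the series for different [x] share one
    enumeration and compare term by term. *)
Definition below_series x : nat -> V :=
  series (fun k => if ((Some (f k) : osucc A) < x)%O then a (f k) else 0).

Lemma below_series_None : below_series None = series (fun k => a (f k)).
Proof. by []. Qed.

Lemma below_series_zero x n : is_zero x -> below_series x n = 0.
Proof. by move=> xz; apply: big1 => k _; rewrite ltNge xz. Qed.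

Lemma below_series_eq x l n : (x <= l)%O ->
  (forall k, (k < n)%N -> below l k -> below x k) ->
  below_series l n = below_series x n.
Proof.
move=> xl H; rewrite /below_series !seriesEord; apply: eq_bigr => k _.
suff -> : ((Some (f k) : osucc A) < l)%O = ((Some (f k) : osucc A) < x)%O by [].
by apply/idP/idP; [exact: H | move/lt_le_trans; apply].
Qed.

(** Passing from [i] to its successor admits only the index [i], which [f] lists at position
    [g i]. *)
Lemma below_series_succ (g : A -> nat) i x n : cancel f g -> cancel g f ->
  is_succ (Some i : osucc A) x ->
  below_series x n = below_series (Some i) n + (if (g i < n)%N then a i else 0).
Proof.
move=> fK gK [ix xmin].
have E k : ((Some (f k) : osucc A) < x)%O =
    ((Some (f k) : osucc A) < Some i)%O || (k == g i).
  rewrite -(can2_eq fK gK); apply/idP/idP => [fx|].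
    rewrite orbC; have [//|] := eqVneq; rewrite orFb => ne.
    rewrite ltNge; apply/negP => le.
    have /xmin : ((Some i : osucc A) < Some (f k))%O.
      by rewrite lt_neqAle le andbT; apply: contra ne => /eqP[->].
    by rewrite leNgt fx.
  by case/orP => [/lt_trans|/eqP->]; [apply|].
elim: n => [|n IH]; first by rewrite /below_series /series /= !big_geq ?addr0.
rewrite /below_series !seriesSr -!/(below_series _ _) {}IH E ltnS -!addrA.
congr (_ + _); case: (ltngtP (g i) n) => [lt|gt|<-].
- by rewrite orbF addrC.
- by rewrite orbF addrC.
by rewrite gK orbT ltxx !add0r.
Qed.

End Partial.

Context (K : numFieldType) (X : completeNormedModType K) (a : A -> X).
Context (g : A -> nat) (fK : cancel f g) (gK : cancel g f).
Hypothesis A_wo : well_order (<=%O : rel A).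

Let b x := below_series (fun i => `|a i|) x.

Lemma below_series_norm_mono x y m n : (m <= n)%N -> (x <= y)%O ->
  b x m <= b y n.
Proof.
move=> mn xy; rewrite -subr_ge0; have -> : b y n - b x m =
    (b y n - b y m) + (b y m - b x m) by rewrite addrA subrK.
apply: addr_ge0.
  rewrite sub_series mn; apply: sumr_ge0 => k _.
  by case: ifP.
rewrite subr_ge0; apply: ler_sum => k _.
case: ifPn => [fx|_]; first by rewrite (lt_le_trans fx xy).
by case: ifP.
Qed.

(** Bounding by the full series of norms, at [None], makes the estimate uniform in [x]. *)
Lemma below_series_dominated x m n : (m <= n)%N ->
  `|below_series a x n - below_series a x m| <= b None n - b None m.
Proof.
move=> mn; rewrite !sub_series mn; apply: le_trans (ler_norm_sum _ _ _) _.
by apply: ler_sum => k _; case: ifP; rewrite ?normr0.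
Qed.

(** Being a supremum is stated as an upper bound with approximation, since suprema need not exist in
    [K]. *)
Lemma abs_sigma_sup (s : osucc A -> K^o) :
  partial_sum_hyperseq (fun i => `|a i| : K^o) setT s ->
  forall x, (forall n, b x n <= s x) /\
    forall e, 0 < e -> exists N, s x - b x N < e.
Proof.
move=> [_ s0 sS sL]; elim/(osucc_ind A_wo) => x IH.
have [zx|nzx] := pselect (is_zero x).
  rewrite s0 //; split=> [n|e e0]; first by rewrite /b below_series_zero.
  by exists 0%N; rewrite /b below_series_zero ?subr0.
have [[[i|] ix]|nsx] := pselect (exists y, is_succ y x); last 2 first.
- by case: ix => + _; case: x {IH nzx}.
- have lx : is_limit x by [].
  have bs n : b x n <= s x.
    have [y yx yb] := limit_bound n lx.
    (* For [z] below [x] and close to it, [b x n] equals [b z n], so the induction hypothesis makes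
       [s z - b x n] a nonnegative approximation of [s x - b x n]. *)
    rewrite -subr_ge0; apply: ge0_of_approx => e e0.
    have [x0 x0x Hx0] := sL x I lx e e0.
    pose z := Order.max x0 y.
    have zx : (z < x)%O by rewrite gt_max x0x yx.
    have yz : (y <= z)%O by rewrite le_max lexx orbT.
    exists (s z - b x n).
      rewrite subr_ge0 /b (below_series_eq _ (ltW zx)); first exact: (IH z zx).1.
      by move=> k kn /(yb _ kn)/lt_le_trans; apply.
    rewrite opprB addrA subrK; apply: Hx0 => //.
    by rewrite le_max lexx.
  split=> // e e0.
  have e20 : 0 < e / 2 by rewrite divr_gt0.
  have [y yx Hy] := sL x I lx _ e20.
  have [bsy /(_ _ e20)[N HN]] := IH y yx.
  exists N; apply: le_lt_trans (_ : s x - b y N < e).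
    by rewrite lerD2l lerN2; apply: below_series_norm_mono (ltW yx).
  (* The order of [K] may be partial: [s x - s y] is bounded by its norm only once both values are
     known to be real. *)
  have sr z : 0 <= b z 0%N -> b z 0%N <= s z -> s z \is Num.real.
    by move=> b0 bz; apply: ger0_real; exact: le_trans bz.
  have b0 z : 0 <= b z 0%N by rewrite /b /below_series /series /= big_geq.
  rewrite -(subrK (s y) (s x)) -addrA [ltRHS]splitr; apply: ltrD => //.
  apply: le_lt_trans (Hy y (lexx _) yx).
  by apply/real_ler_norm/realB; apply: sr.
have [bsi Hi] := IH (Some i) ix.1.
have ai0 : 0 <= `|a i| by [].
rewrite (sS i) //; split=> [n|e e0].
  rewrite /b (below_series_succ _ _ fK gK ix) lerD //.
  by case: ifP.
(* From [(g i).+1] on, the finite sums contain the new term [a i]. *)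
have [N HN] := Hi e e0; exists (maxn N (g i).+1).
rewrite /b (below_series_succ _ _ fK gK ix) leq_maxr opprD addrACA subrr addr0.
by apply: le_lt_trans HN; rewrite lerD2l lerN2 below_series_norm_mono ?leq_maxl.
Qed.

(** The limit clause is an exchange of limits: the tails after [N] are small uniformly in [x], and
    the first [N] terms do not change between [l] and any [x] close enough below it. *)
Lemma rearranged_hyperseq (L : K) :
  (forall n, b None n <= L) -> (forall e, 0 < e -> exists N, L - b None N < e) ->
  partial_sum_hyperseq a setT (fun x => limn (below_series a x)).
Proof.
move=> bL Lb.
have dom x := cvg_dominated (below_series_dominated x) bL Lb.
split=> //.
- by split=> //; exists None.
- move=> x _ xz; have -> : below_series a x = fun=> 0.
    by apply/funext => n; exact: below_series_zero.
  exact: lim_cst.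
- move=> i x _ ix; apply/cvg_lim => //.
  have -> : below_series a x = below_series a (Some i) \+
      (fun n => if (g i < n)%N then a i else 0).
    by apply/funext => n; exact: below_series_succ.
  apply: cvgD; first exact: (dom _).1.
  apply: cvg_near_cst; exists (g i).+1 => // n /= gin.
  by rewrite gin.
- move=> l _ ll e e0.
  have e20 : 0 < e / 2 by rewrite divr_gt0.
  have [N HN] := Lb _ e20.
  have [y yl yb] := limit_bound N ll.
  exists y => // x yx xl.
  have E : below_series a l N = below_series a x N.
    apply: below_series_eq (ltW xl) _ => k kN /(yb _ kN) fy.
    exact: lt_le_trans yx.
  rewrite -(subrK (below_series a l N) (limn (below_series a l))) -addrA.
  apply: le_lt_trans (ler_normD _ _) _; rewrite [ltRHS]splitr; apply: ltrD.
    exact: le_lt_trans ((dom l).2 N) HN.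
  by rewrite E distrC; exact: le_lt_trans ((dom x).2 N) HN.
Qed.

End Rearrangement.

Theorem theorem4p2 (K : numFieldType) (X : completeNormedModType K)
  (d : Order.disp_t) (A : orderType d)
  (A_wo : well_order (<=%O : rel A))
  (A_countable : countable [set: A]) (A_infinite : infinite_set [set: A])
  (a : A -> X) (a_abs : wo_abs_converges a)
  (f : nat -> A) (f_bij : bijective f) :
  [/\ wo_converges a,
      cvgn [normed series (fun i => a (f i))]
    & series (fun i => a (f i)) @ \oo --> wo_sum a].
Proof.
have [g fK gK] := f_bij.
have := sigmaP A_wo (fun i => `|a i| : K^o).
rewrite [sigma_dom _]a_abs => /(abs_sigma_sup fK gK A_wo)/(_ None).
(* [L] is the well-ordered sum of the norms, hence the supremum of the finite sums of the rearranged
   norms. *)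
set L := sigma _ None => -[bL Lb].
have hs := rearranged_hyperseq fK gK bL Lb.
split.
- by apply/seteqP; split=> // x _; exact: (sigma_max A_wo hs).1.
- apply/cvg_ex; exists L; apply/cvgrPdist_lt => e e0.
  have [N HN] := Lb e e0; exists N => // n /= Nn.
  rewrite ger0_norm ?subr_ge0; last exact: bL.
  apply: le_lt_trans HN; rewrite lerD2l lerN2.
  exact: (below_series_norm_mono f a Nn (lexx _)).
(* Uniqueness of partial sums identifies [sigma a None] with the limit of the series at [None],
   where no term is suppressed. *)
- rewrite /wo_sum (sigmaE A_wo hs) // -below_series_None.
  by have [] := cvg_dominated (below_series_dominated f a None) bL Lb.
Qed.
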